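(* Let $X$ and $Y$ be smooth manifolds and let $T$ be a top space. Suppose $F:X\to Y$ is a smooth map that is equivariant with respect to a transitive perfect smooth generalized action $\lambda$ of $T$ on $X$ and a perfect smooth generalized action $\theta$ of $T$ on $Y$. Then $F$ has constant rank.
   Context: A generalized group is a semigroup $T$ such that (i) for each $t\in T$ there exists a unique $e(t)\in T$ with $t\cdot e(t)=e(t)\cdot t=t$; (ii) for each $t\in T$ there exists $s\in T$ with $s\cdot t=t\cdot s=e(t)$. The element $s$ in (ii) is unique and denoted $t^{-1}$. A topological generalized group is a Hausdorff topological space $T$ endowed with a generalized group structure such that the maps $m_1:T\to T$, $t\mapsto t^{-1}$, and $m_2:T\times T\to T$, $(s,t)\mapsto s\cdot t$, are continuous and $e(s\cdot t)=e(s)\cdot e(t)$ for all $s,t\in T$. A top space is a Hausdorff $d$-dimensional differentiable manifold $T$ which is also a topological generalized group such that $m_1$ and $m_2$ are smooth. A generalized action of a topological generalized group $T$ on a topological space $X$ is a continuous map $\lambda:T\times X\to X$ such that (i) $\lambda(s,\lambda(t,x))=\lambda(s\cdot t,x)$ for all $s,t\in T$, $x\in X$; (ii) for each $x\in X$ there is an element of the form $e(t)\in T$ with $\lambda(e(t),x)=x$. It is smooth if $\lambda$ is a smooth map; transitive if for all $x,y\in X$ there is $t\in T$ with $\lambda(t,x)=y$; perfect if $\lambda(e(t),x)=x$ for all $t\in T$ and $x\in X$. The map $F:X\to Y$ is equivariant with respect to generalized actions $\lambda$ on $X$ and $\theta$ on $Y$ if $F(\lambda(t,x))=\theta(t,F(x))$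 for all $t\in T$, $x\in X$. $F$ has constant rank if the rank of its differential $dF_x$ is the same for all $x\in X$. *)

(* Defs.v *)
From HB Require Import structures.
From mathcomp Require Import all_boot all_order all_algebra.
From mathcomp Require Import all_classical all_reals all_analysis.
Import numFieldNormedType.Exports.

Set Implicit Arguments.
Unset Strict Implicit.
Unset Printing Implicit Defensive.

Local Open Scope classical_set_scope.
Local Open Scope ring_scope.

(* C^k and C^oo maps on an open subset U of R^m. The functions are total, but  *)
(* since U is open the conditions below only involve their values on U.        *)
Fixpoint class_C (R : realType) (m n k : nat) (U : set 'rV[R]_m)
    (f : 'rV[R]_m -> 'rV[R]_n) : Prop :=
  match k with
  | 0%N => forall u, U u -> {for u, continuous f}
  | k'.+1 => (forall u, U u -> differentiable f u) /\
             (forall v : 'rV[R]_m, class_C k' U (fun u => 'D_v f u))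
  end.

Definition smooth_on (R : realType) (m n : nat) (U : set 'rV[R]_m)
    (f : 'rV[R]_m -> 'rV[R]_n) : Prop :=
  forall k, class_C k U f.

(* Charts (dom i, phi i) on X indexed by idx; psi i is the inverse of phi i,   *)
(* extended arbitrarily outside phi i @` dom i. The chart selected by chart_at *)
(* witnesses that the domains cover X. These are only the data: the axioms are *)
(* in smooth_manifold.                                                         *)
Record atlas (R : realType) (m : nat) (X : topologicalType) := Atlas {
  idx : Type;
  dom : idx -> set X;
  phi : idx -> X -> 'rV[R]_m;
  psi : idx -> 'rV[R]_m -> X;
  chart_at : forall x : X, {i : idx | dom i x} }.

Definition is_chart (R : realType) (m : nat) (X : topologicalType)
    (A : atlas R m X) (i : idx A) : Prop :=
  [/\ open (dom i),
      open (phi i @` dom i),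
      forall x, dom i x -> psi i (phi i x) = x,
      forall x, dom i x -> {for x, continuous (phi i)} &
      forall u, (phi i @` dom i) u -> {for u, continuous (psi i)}].

Definition smooth_manifold (R : realType) (m : nat) (X : topologicalType)
    (A : atlas R m X) : Prop :=
  [/\ hausdorff_space X,
      forall i : idx A, is_chart i &
      forall i j : idx A,
        smooth_on (phi i @` (dom i `&` dom j)) (phi j \o psi i)].

Definition smooth_map (R : realType) (m n : nat) (X Y : topologicalType)
    (A : atlas R m X) (B : atlas R n Y) (F : X -> Y) : Prop :=
  continuous F /\
  forall (i : idx A) (j : idx B),
    smooth_on (phi i @` (dom i `&` F @^-1` dom j)) (phi j \o F \o psi i).

Definition prod_atlas (R : realType) (m n : nat) (X Y : topologicalType)
    (A : atlas R m X) (B : atlas R n Y) :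
    atlas R (m + n) (X * Y)%type :=
  @Atlas R (m + n) (X * Y)%type (idx A * idx B)%type
    (fun ij => dom ij.1 `*` dom ij.2)
    (fun ij z => row_mx (phi ij.1 z.1) (phi ij.2 z.2))
    (fun ij u => (psi ij.1 (lsubmx u), psi ij.2 (rsubmx u)))
    (fun z => exist _ (sval (chart_at A z.1), sval (chart_at B z.2))
                (conj (svalP (chart_at A z.1)) (svalP (chart_at B z.2)))).

(* The tangent space at x: families of vectors, one for each chart around x,   *)
(* that correspond to each other under the differentials of the changes of     *)
(* charts.                                                                     *)
Definition charts_around (R : realType) (m : nat) (X : topologicalType)
    (A : atlas R m X) (x : X) : Type := {i : idx A | dom i x}.

Definition tangent_space (R : realType) (m : nat) (X : topologicalType)
    (A : atlas R m X) (x : X) : set (charts_around A x -> 'rV[R]_m) :=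
  [set v | forall i j : charts_around A x,
     v j = 'd (phi (sval j) \o psi (sval i)) (phi (sval i) x) (v i)].

Arguments tangent_space {R m X} A x.

(* The differential dF_x, computed in the chart chart_at A x; on tangent       *)
(* vectors the choice of that chart is immaterial.                             *)
Definition differential (R : realType) (m n : nat) (X Y : topologicalType)
    (A : atlas R m X) (B : atlas R n Y) (F : X -> Y) (x : X)
    (v : charts_around A x -> 'rV[R]_m) : charts_around B (F x) -> 'rV[R]_n :=
  let i := chart_at A x in
  fun j => 'd (phi (sval j) \o F \o psi (sval i)) (phi (sval i) x) (v i).

Arguments differential {R m n X Y} A B F x v.

Definition has_dim (R : realType) (V : lmodType R) (S : set V) (r : nat)
    : Prop :=
  exists b : 'I_r -> V,
    (forall c : 'I_r -> R, \sum_i c i *: b i = 0 -> forall i, c i = 0) /\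
    S = [set \sum_i c i *: b i | c in [set: 'I_r -> R]].

Definition has_rank_at (R : realType) (m n : nat) (X Y : topologicalType)
    (A : atlas R m X) (B : atlas R n Y) (F : X -> Y) (x : X) (r : nat)
    : Prop :=
  has_dim (differential A B F x @` tangent_space A x) r.

Definition has_constant_rank (R : realType) (m n : nat)
    (X Y : topologicalType) (A : atlas R m X) (B : atlas R n Y) (F : X -> Y)
    : Prop :=
  exists r : nat, forall x : X, has_rank_at A B F x r.

(* gid t is e(t) and ginv t is t^-1. *)
Record generalized_group (T : Type) := GeneralizedGroup {
  gmul : T -> T -> T;
  gid : T -> T;
  ginv : T -> T;
  gmulA : forall s t u, gmul s (gmul t u) = gmul (gmul s t) u;
  gidP : forall t, gmul t (gid t) = t /\ gmul (gid t) t = t;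
  gid_unique : forall t u, gmul t u = t -> gmul u t = t -> u = gid t;
  ginvP : forall t, gmul (ginv t) t = gid t /\ gmul t (ginv t) = gid t }.

Definition topological_generalized_group (T : topologicalType)
    (G : generalized_group T) : Prop :=
  [/\ hausdorff_space T,
      continuous (ginv G),
      continuous (fun st : T * T => gmul G st.1 st.2) &
      forall s t, gid G (gmul G s t) = gmul G (gid G s) (gid G t)].

Definition top_space (R : realType) (d : nat) (T : topologicalType)
    (A : atlas R d T) (G : generalized_group T) : Prop :=
  [/\ smooth_manifold A,
      topological_generalized_group G,
      smooth_map A A (ginv G) &
      smooth_map (prod_atlas A A) A (fun st : T * T => gmul G st.1 st.2)].

Definition generalized_action (T X : topologicalType)
    (G : generalized_group T) (lam : T * X -> X) : Prop :=
  [/\ continuous lam,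
      forall s t x, lam (s, lam (t, x)) = lam (gmul G s t, x) &
      forall x, exists t, lam (gid G t, x) = x].

Definition smooth_generalized_action (R : realType) (d m : nat)
    (T X : topologicalType) (AT : atlas R d T) (AX : atlas R m X)
    (G : generalized_group T) (lam : T * X -> X) : Prop :=
  generalized_action G lam /\ smooth_map (prod_atlas AT AX) AX lam.

Definition transitive_action (T X : Type) (lam : T * X -> X) : Prop :=
  forall x y, exists t, lam (t, x) = y.

Definition perfect_action (T X : Type) (G : generalized_group T)
    (lam : T * X -> X) : Prop :=
  forall t x, lam (gid G t, x) = x.

Definition equivariant (T X Y : Type) (lam : T * X -> X) (theta : T * Y -> Y)
    (F : X -> Y) : Prop :=
  forall t x, F (lam (t, x)) = theta (t, F x).

(* Main.v *)
Require Import Defs.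
From mathcomp Require Import all_boot all_order all_algebra.
From mathcomp Require Import all_classical all_reals all_analysis.
Import numFieldNormedType.Exports.

Set Implicit Arguments.
Unset Strict Implicit.
Unset Printing Implicit Defensive.

Local Open Scope classical_set_scope.
Local Open Scope ring_scope.
Import GRing.Theory Num.Theory.

(** For t in the top space, perfectness makes lam (t, -) and theta (t, -)
    bijections, with inverses given by t^-1, since t^-1 t = e(t) acts
    trivially. Equivariance then expresses F through its behaviour elsewhere:
[[
    F = theta (t^-1, -) \o F \o lam (t, -).
]]
    By the chain rule dF_x factors through dF_y for y = lam (t, x), so that the
    rank at x is at most the rank at y. Transitivity allows any y, and
    exchanging x and y gives equality.

    The work is to carry out this argument in charts. The Jacobian matrix of a
    map read in charts obeys the chain rule [chart_jacobian_comp]; this rests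
    on the fact that differentials only depend on germs ([near_eq_diff]), since
    two coordinate expressions of a composite agree only near the point. The
    translation x |-> lam (t, x) is differentiable in charts because its
    coordinate expression is that of lam composed with an affine map
    ([chart_diff_map_section]). Finally [has_rank_at_chart_jacobian] identifies
    the rank of dF_x, defined on compatible families of vectors, with the rank
    of one matrix. *)

(** * Differentials and Jacobians of maps between normed spaces *)

(** Both the value at x and the first-order expansion at x are determined by
    the germ, and the differential is the only continuous linear map that fits the
    expansion. *)
Lemma near_eq_diff (R : numFieldType) (V W : normedModType R) (f g : V -> W)
    (x : V) :
  differentiable f x -> (\forall y \near x, f y = g y) ->
  is_diff x g ('d f x).
Proof.
move=> df fg; have dfc : continuous ('d f x) by exact: diff_continuous.
have gE : g \o shift x = cst (g x) + 'd f x +o_ 0 id.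
  have /eqaddoP fE := diff_locally df.
  apply/eqaddoP => e e0; have := fE e e0.
  have : \forall h \near 0, f (h + x) = g (h + x).
    have := fg; rewrite (near_shift 0); apply: filterS => h.
    by rewrite /= subr0.
  apply: filterS2 => h fgh; rewrite !fctE /= fgh.
  by rewrite (nbhs_singleton fg).
have dgE : 'd g x = 'd f x :> (V -> W) by exact: diff_unique.
apply: DiffDef; last exact: dgE.
by apply/diff_locallyP; rewrite dgE.
Qed.

Lemma near_eq_jacobian (R : numFieldType) (m n : nat)
    (f g : 'rV[R]_m -> 'rV[R]_n) (u : 'rV[R]_m) :
  differentiable f u -> (\forall v \near u, f v = g v) -> 'J f u = 'J g u.
Proof.
move=> df fg; have [_ dE] := near_eq_diff df fg.
exact: (congr1 (@lin1_mx R m n) (esym dE)).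
Qed.

Lemma jacobian_comp (R : numFieldType) (m n p : nat)
    (f : 'rV[R]_m -> 'rV[R]_n) (g : 'rV[R]_n -> 'rV[R]_p) (u : 'rV[R]_m) :
  differentiable f u -> differentiable g (f u) ->
  'J (g \o f) u = 'J f u *m 'J g (f u).
Proof.
move=> df dg; apply/row_matrixP => k.
by rewrite [LHS]rowE [RHS]rowE mulmxA /jacobian !mul_rV_lin1 diff_comp.
Qed.

Lemma jacobian_id (R : numFieldType) (m : nat) (u : 'rV[R]_m) : 'J id u = 1%:M.
Proof.
apply/row_matrixP => k.
by rewrite [LHS]rowE [RHS]rowE mulmx1 /jacobian mul_rV_lin1 diff_val.
Qed.

(** [row_mx a] is affine: a constant plus the linear map v |-> (0, v). *)
Lemma differentiable_row_mx (R : numFieldType) (d m : nat) (a : 'rV[R]_d)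
    (u : 'rV[R]_m) : differentiable (row_mx a : 'rV[R]_m -> 'rV[R]_(d + m)) u.
Proof.
have -> : row_mx a = cst (row_mx a 0) + mulmxr (row_mx (0 : 'M[R]_(m, d)) 1%:M).
  apply/funext => v /=.
  by rewrite !fctE/= mul_mx_row mulmx0 mulmx1 add_row_mx addr0 add0r.
apply: differentiableD => //; apply: linear_differentiable => v A.
move=> /nbhs_ballP[e /= e0 eA]; apply/nbhs_ballP; exists e => //= w [_ vw].
apply: eA; split => //= i j; rewrite !mul_mx_row !mulmx0 !mulmx1.
case: (split_ordP j) => k ->; rewrite ?row_mxEl ?row_mxEr; last exact: vw.
by rewrite !mxE; exact: ballxx.
Qed.

(** * Maps between manifolds read in charts *)

Section Charts.
Variable R : realType.

(** First-order part of [smooth_map]: the chain rule asks for no more, and this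
    part is easily seen to be stable under composition. *)
Definition chart_diff_map (m n : nat) (X Y : topologicalType)
    (A : atlas R m X) (B : atlas R n Y) (f : X -> Y) : Prop :=
  continuous f /\
  forall i j x, dom (a := A) i x -> dom (a := B) j (f x) ->
    differentiable (phi j \o f \o psi i) (phi i x).

(** Acts on row vectors from the right, so that composition of maps reverses the
    order of the factors. *)
Definition chart_jacobian (m n : nat) (X Y : topologicalType)
    (A : atlas R m X) (B : atlas R n Y) (f : X -> Y) (i : idx A) (j : idx B)
    (x : X) : 'M[R]_(m, n) :=
  'J (phi j \o f \o psi i) (phi i x).

Lemma smooth_map_chart_diff (m n : nat) (X Y : topologicalType)
    (A : atlas R m X) (B : atlas R n Y) (f : X -> Y) :
  smooth_map A B f -> chart_diff_map A B f.
Proof.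
move=> [fc fs]; split=> // i j x ix jfx.
by have [+ _] := fs i j 1%N; apply; exists x.
Qed.

Lemma chart_diff_map_id (m : nat) (X : topologicalType) (A : atlas R m X) :
  smooth_manifold A -> chart_diff_map A A id.
Proof.
move=> [_ _ As]; apply: smooth_map_chart_diff; split; last exact: As.
by move=> x; exact: cvg_id.
Qed.

Lemma near_chart (m : nat) (X : topologicalType) (A : atlas R m X) (i : idx A)
    (x : X) (P : X -> Prop) :
  smooth_manifold A -> dom i x -> (\near x, P x) ->
  \forall u \near phi i x, P (psi i u).
Proof.
move=> [_ /(_ i)[_ _ ix_ _ psic] _] ix xP.
have /psic : (phi i @` dom i) (phi i x) by exists x.
by rewrite /prop_for /continuous_at ix_//; apply.
Qed.

Lemma near_dom (m : nat) (X : topologicalType) (A : atlas R m X) (i : idx A)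
    (x : X) : smooth_manifold A -> dom i x -> \near x, dom i x.
Proof. by move=> [_ /(_ i)[iO _ _ _ _] _] ix; exact: open_nbhs_nbhs. Qed.

Lemma psiK (m : nat) (X : topologicalType) (A : atlas R m X) (i : idx A)
    (x : X) : smooth_manifold A -> dom i x -> psi i (phi i x) = x.
Proof. by move=> [_ /(_ i)[_ _ iK _ _] _]; exact: iK. Qed.

(** The two sides differ where f leaves the domain of the chart j, because
    [psi j] only inverts [phi j] on that domain; continuity of f keeps f inside
    it near x. *)
Lemma near_chart_comp (m n p : nat) (X Y Z : topologicalType)
    (A : atlas R m X) (B : atlas R n Y) (C : atlas R p Z)
    (f : X -> Y) (g : Y -> Z) (i : idx A) (j : idx B) (k : idx C) (x : X) :
  smooth_manifold A -> smooth_manifold B -> continuous f ->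
  dom i x -> dom j (f x) ->
  \forall u \near phi i x,
    ((phi k \o g \o psi j) \o (phi j \o f \o psi i)) u =
    (phi k \o (g \o f) \o psi i) u.
Proof.
move=> hA hB fc ix jfx.
have : \near x, dom j (f x) by apply: fc; exact: near_dom.
by move=> /(near_chart hA ix); apply: filterS => u ju /=; rewrite psiK.
Qed.

Lemma chart_diff_map_comp (m n p : nat) (X Y Z : topologicalType)
    (A : atlas R m X) (B : atlas R n Y) (C : atlas R p Z)
    (f : X -> Y) (g : Y -> Z) :
  smooth_manifold A -> smooth_manifold B ->
  chart_diff_map A B f -> chart_diff_map B C g -> chart_diff_map A C (g \o f).
Proof.
move=> hA hB [fc fd] [gc gd]; split=> [x|i k x ix kx].
  by apply: continuous_comp; [exact: fc|exact: gc].
have [j jfx] := chart_at B (f x).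
have gfE := near_chart_comp (C := C) g k hA hB fc ix jfx.
suff dgf : differentiable
    ((phi k \o g \o psi j) \o (phi j \o f \o psi i)) (phi i x).
  by have [] := near_eq_diff dgf gfE.
apply: differentiable_comp; first exact: fd.
by rewrite /= psiK//; exact: gd.
Qed.

Lemma chart_jacobian_comp (m n p : nat) (X Y Z : topologicalType)
    (A : atlas R m X) (B : atlas R n Y) (C : atlas R p Z)
    (f : X -> Y) (g : Y -> Z) (i : idx A) (j : idx B) (k : idx C) (x : X) :
  smooth_manifold A -> smooth_manifold B ->
  chart_diff_map A B f -> chart_diff_map B C g ->
  dom i x -> dom j (f x) -> dom k (g (f x)) ->
  chart_jacobian (g \o f) i k x =
    chart_jacobian f i j x *m chart_jacobian g j k (f x).
Proof.
move=> hA hB [fc fd] [_ gd] ix jfx kgfx.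
have df := fd _ _ _ ix jfx; have dg := gd _ _ _ jfx kgfx.
have E : phi j (f x) = (phi j \o f \o psi i) (phi i x) by rewrite /= psiK.
rewrite E in dg.
have gfE := near_chart_comp (C := C) g k hA hB fc ix jfx.
rewrite /chart_jacobian [X in _ *m 'J _ X]E -(jacobian_comp df dg).
by apply/esym/near_eq_jacobian => //; exact: differentiable_comp.
Qed.

(** [chart_jacobian id i k] is the change of charts on tangent vectors, and
    [phi i \o psi i] is the identity near [phi i x] as the chart has open
    image. So transporting a vector from the chart i to all the charts keeps
    its component in i. *)
Lemma chart_jacobian_id (m : nat) (X : topologicalType) (A : atlas R m X)
    (i : idx A) (x : X) :
  smooth_manifold A -> dom i x -> chart_jacobian id i i x = 1%:M.
Proof.
move=> hA ix; rewrite -(jacobian_id (phi i x)).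
have [_ idd] := chart_diff_map_id hA.
apply: near_eq_jacobian; first exact: idd.
have [_ /(_ i)[_ Oi iK _ _] _] := hA.
have : \forall u \near phi i x, (phi i @` dom i) u.
  by apply: open_nbhs_nbhs; split => //; exists x.
by apply: filterS => _ [y iy <-] /=; rewrite iK.
Qed.

(** A tangent vector is determined by its component in one chart, which may be
    arbitrary; likewise the image vectors at F x are recovered from their
    component in the chart j by the injective linear map [Psi]. Hence the image
    of dF_x is the image under [Psi] of the row space of the matrix. *)
Lemma has_rank_at_chart_jacobian (m n : nat) (X Y : topologicalType)
    (A : atlas R m X) (B : atlas R n Y) (F : X -> Y) (j : idx B) (x : X) :
  smooth_manifold A -> smooth_manifold B -> chart_diff_map A B F ->
  dom j (F x) ->
  has_rank_at A B F x
    (\rank (chart_jacobian F (sval (chart_at A x)) j x)).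
Proof.
move=> hA hB hF jFx.
pose i : charts_around A x := chart_at A x.
set M := chart_jacobian F (sval i) j x.
pose j0 : charts_around B (F x) := exist _ j jFx.
pose Psi (z : 'rV[R]_n) : charts_around B (F x) -> 'rV[R]_n :=
  fun k => z *m chart_jacobian id j (sval k) (F x).
have idA := chart_diff_map_id hA; have idB := chart_diff_map_id hB.
have Psi_j0 z : Psi z j0 = z.
  by rewrite /Psi /= chart_jacobian_id// mulmx1.
have Psi_sum r (c : 'I_r -> R) (w : 'I_r -> 'rV[R]_n) :
    \sum_k c k *: Psi (w k) = Psi (\sum_k c k *: w k).
  apply/funext => k; rewrite fct_sumE /Psi mulmx_suml.
  by apply: eq_bigr => l _; rewrite fctE scalemxAl.
have imageE : differential A B F x @` tangent_space A x =
    [set Psi (w *m M) | w in [set: 'rV[R]_m]].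
  have dE v : differential A B F x v = Psi (v i *m M).
    apply/funext => k; rewrite /differential /Psi -mulmxA.
    rewrite -(@chart_jacobian_comp _ _ _ _ _ _ A B B F id)//; last 2 first.
    - exact: (svalP i).
    - exact: (svalP k).
    by rewrite /chart_jacobian /jacobian mul_rV_lin1.
  apply/seteqP; split=> [_ [v _ <-]|_ [w _ <-]].
    by exists (v i); rewrite // dE.
  (* The family that transports w from the chart i to all others. *)
  exists (fun k => w *m chart_jacobian id (sval i) (sval k) x).
    move=> k l; have -> : forall z : 'rV[R]_m,
      'd (phi (sval l) \o psi (sval k)) (phi (sval k) x) z =
      z *m chart_jacobian id (sval k) (sval l) x.
      by move=> z; rewrite /chart_jacobian /jacobian mul_rV_lin1.
    rewrite -mulmxA -(@chart_jacobian_comp _ _ _ _ _ _ A A A id id)//;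
      [exact: (svalP i)|exact: (svalP k)|exact: (svalP l)].
  by rewrite dE chart_jacobian_id ?mulmx1//; exact: (svalP i).
rewrite /has_rank_at imageE.
(* A basis of the row space of M, transported by Psi. *)
exists (fun k => Psi (row k (row_base M))); split=> [c|].
  rewrite Psi_sum => /(congr1 (fun f => f j0)); rewrite Psi_j0.
  have -> : \sum_k c k *: row k (row_base M) = (\row_k c k) *m row_base M.
    by rewrite mulmx_sum_row; apply: eq_bigr => k _; rewrite mxE.
  rewrite -[RHS]/(0 : 'rV[R]_n) -(mul0mx _ (row_base M)).
  move=> /(row_free_inj (row_base_free M)) /rowP c0 k.
  by have := c0 k; rewrite !mxE.
have Psi_row (w : 'rV[R]_(\rank M)) :
    \sum_k w 0 k *: Psi (row k (row_base M)) = Psi (w *m row_base M).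
  by rewrite Psi_sum mulmx_sum_row.
apply/seteqP; split=> [_ [w _ <-]|_ [c _ <-]].
  have /submxP[z ->] : (w *m M <= row_base M)%MS by rewrite eq_row_base submxMl.
  by exists (fun k => z 0 k).
have /submxP[z zE] : ((\row_k c k) *m row_base M <= M)%MS.
  by rewrite -(eq_row_base M) submxMl.
exists z => //; rewrite -zE -Psi_row; apply: eq_bigr => k _.
by rewrite mxE.
Qed.

(** With a chart a around t, the coordinate expression of lam (t, -) is that of
    lam precomposed with u |-> (phi a t, u). *)
Lemma chart_diff_map_section (d m n : nat) (T X Y : topologicalType)
    (AT : atlas R d T) (AX : atlas R m X) (AY : atlas R n Y)
    (lam : T * X -> Y) (t : T) :
  smooth_manifold AT ->
  smooth_map (prod_atlas AT AX) AY lam ->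
  chart_diff_map AX AY (fun x => lam (t, x)).
Proof.
move=> hT /smooth_map_chart_diff [lc ld]; split=> [x|i j x ix jx].
  apply: (@continuous_comp _ _ _ (fun x => (t, x)) lam); last exact: lc.
  by apply: cvg_pair; [exact: cvg_cst|exact: cvg_id].
have at_t := svalP (chart_at AT t); set a := sval (chart_at AT t) in at_t.
have := ld (a, i) j (t, x) (conj at_t ix) jx => /= {}ld.
have -> : phi j \o (fun x => lam (t, x)) \o psi i =
    (phi j \o lam \o (fun u : 'rV[R]_(d + m) =>
      (psi a (lsubmx u), psi i (rsubmx u)))) \o row_mx (phi a t).
  by apply/funext => u /=; rewrite row_mxKl row_mxKr psiK.
by apply: differentiable_comp; first exact: differentiable_row_mx.
Qed.

End Charts.

(** * Equivariant maps have constant rank *)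

Theorem theorem3p8 (R : realType) (d m n : nat) (T X Y : topologicalType)
    (AT : atlas R d T) (AX : atlas R m X) (AY : atlas R n Y)
    (G : generalized_group T)
    (lam : T * X -> X) (theta : T * Y -> Y) (F : X -> Y)
    (hX : smooth_manifold AX) (hY : smooth_manifold AY)
    (hT : top_space AT G)
    (hlam : smooth_generalized_action AT AX G lam)
    (hlam_trans : transitive_action lam)
    (hlam_perf : perfect_action G lam)
    (htheta : smooth_generalized_action AT AY G theta)
    (htheta_perf : perfect_action G theta)
    (hF : smooth_map AX AY F)
    (hF_equi : equivariant lam theta F) :
  has_constant_rank AX AY F.
Proof.
have [hTm _ _ _] := hT.
have hFd := smooth_map_chart_diff hF.
have [[_ thetaA _] thetaS] := htheta.
pose rk x := \rank (chart_jacobian (A := AX) (B := AY) F (sval (chart_at AX x))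
  (sval (chart_at AY (F x))) x).
have rkP x : has_rank_at AX AY F x (rk x).
  by apply: has_rank_at_chart_jacobian => //; exact: (svalP (chart_at AY (F x))).
have rk_le x y : (rk x <= rk y)%N.
  have [t <-] := hlam_trans x y.
  set f := fun z => lam (t, z).
  set g := fun z => theta (ginv G t, z).
  have hf : chart_diff_map AX AX f.
    by apply: chart_diff_map_section hTm _; exact: hlam.2.
  have hg : chart_diff_map AY AY g by exact: chart_diff_map_section hTm _.
  have gFf : g \o (F \o f) = F.
    apply/funext => z; rewrite /g /f /= hF_equi thetaA (ginvP G t).1.
    exact: htheta_perf.
  have ix := svalP (chart_at AX x); have jFx := svalP (chart_at AY (F x)).
  have ify := svalP (chart_at AX (f x)).
  have jFy := svalP (chart_at AY (F (f x))).
  have jgFy : dom (sval (chart_at AY (F x))) (g (F (f x))).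
    by have /= -> := congr1 (fun h => h x) gFf.
  have := chart_jacobian_comp hX hY (chart_diff_map_comp hX hX hf hFd) hg
    ix jFy jgFy.
  rewrite gFf /rk -/(f x) => ->.
  rewrite (chart_jacobian_comp hX hX hf hFd ix ify jFy).
  exact: leq_trans (mxrankM_maxl _ _) (mxrankM_maxr _ _).
clearbody rk.
(* If X is empty, any rank will do. *)
case: (pselect (exists x : X, True)) => [[x0 _]|X0]; last first.
  by exists 0%N => x; case: X0; exists x.
exists (rk x0) => x.
have -> : rk x0 = rk x by apply/eqP; rewrite eqn_leq !rk_le.
exact: rkP.
Qed.
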